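(* Let $n\ge2$, let $(\mathcal{A},[\cdot,\cdots,\cdot],\mu,\alpha)$ be an $n$-ary Hom-Nambu Poisson superalgebra, let $V$ be a $\mathbb{Z}_2$-graded vector space, and let $\rho:\Lambda^{n-1}\mathcal{A}\to \mathfrak{gl}(V)$, $\eta:\mathcal{A}\to \mathfrak{gl}(V)$ and $\alpha_V:V\to V$ be even linear maps. Then $(\mathcal{A}\oplus V,[\cdot,\cdots,\cdot]_{\mathcal{A}\oplus V},\mu_{\mathcal{A}\oplus V},\alpha+\alpha_V)$ is an $n$-ary Hom-Nambu Poisson superalgebra if and only if $(V,\rho,\eta,\alpha_V)$ is a representation of $(\mathcal{A},[\cdot,\cdots,\cdot],\mu,\alpha)$, where, for homogeneous $x,y,x_k\in\mathcal{A}$ and $u,v,a_k\in V$, $$\mu_{\mathcal{A}\oplus V}(x+u,y+v)=\mu(x,y)+\eta(x)v+(-1)^{|y||u|}\eta(y)u,\qquad (\alpha+\alpha_V)(x+u)=\alpha(x)+\alpha_V(u),$$ $$[x_1+a_1,\dots,x_n+a_n]_{\mathcal{A}\oplus V}=[x_1,\dots,x_n]+\sum_{k=1}^n(-1)^{|x_k|(|x_{k+1}|+\cdots+|x_n|)}\rho(x_1,\dots,\hat{x_k},\dots,x_n)a_k .$$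
   Context: $\mathbb{K}$ is a field of characteristic zero; all vector spaces are $\mathbb{Z}_2$-graded over $\mathbb{K}$; $|x|$ is the parity of a homogeneous element. Even (multi)linear maps preserve the grading. Identities are required for all homogeneous elements. $\mathfrak{gl}(V)=\mathrm{End}(V)$. A hat denotes omission. A linear map on $\Lambda^{n-1}\mathcal{A}$ is the same as an $(n-1)$-linear super-skew-symmetric map on $\mathcal{A}$. $\mathcal{A}\oplus V$ is graded by $(\mathcal{A}\oplus V)_i=\mathcal{A}_i\oplus V_i$, so a homogeneous $x+u$ has $|x+u|=|x|=|u|$. Commutative Hom-associative superalgebra $(\mathcal{A},\mu,\alpha)$: $\alpha$ even linear, $\mu$ even bilinear, $\mu(\mu(x,y),\alpha(z))=\mu(\alpha(x),\mu(y,z))$, $\mu(x,y)=(-1)^{|x||y|}\mu(y,x)$. $n$-Hom-Lie superalgebra $(\mathcal{A},[\cdot,\cdots,\cdot],\alpha)$: $\alpha$ even linear, $[\cdot,\cdots,\cdot]:\mathcal{A}^n\to\mathcal{A}$ even $n$-linear, super-skew-symmetric, i.e. $[x_1,\dots,x_i,x_{i+1},\dots,x_n]=-(-1)^{|x_i||x_{i+1}|}[x_1,\dots,x_{i+1},x_i,\dots,x_n]$, and $$[\alpha(x_1),\dots,\alpha(x_{n-1}),[y_1,\dots,y_n]]=\sum_{i=1}^n(-1)^{|X|(|y_1|+\cdots+|y_{i-1}|)}[\alpha(y_1),\dots,\alpha(y_{i-1}),[x_1,\dots,x_{n-1},y_i],\alpha(y_{i+1}),\dots,\alpha(y_n)]$$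 with $|X|=\sum_{k=1}^{n-1}|x_k|$. $n$-ary Hom-Nambu Poisson superalgebra $(\mathcal{A},[\cdot,\cdots,\cdot],\mu,\alpha)$: $(\mathcal{A},\mu,\alpha)$ is a commutative Hom-associative superalgebra, $(\mathcal{A},[\cdot,\cdots,\cdot],\alpha)$ is an $n$-Hom-Lie superalgebra, and $$[\alpha(x_1),\dots,\alpha(x_{n-1}),\mu(y,z)]=(-1)^{|y||X|}\mu(\alpha(y),[x_1,\dots,x_{n-1},z])+\mu([x_1,\dots,x_{n-1},y],\alpha(z)).$$ A representation of an $n$-ary Hom-Nambu Poisson superalgebra is a quadruple $(V,\rho,\eta,\alpha_V)$ with $V$ a $\mathbb{Z}_2$-graded vector space and even linear maps $\rho:\Lambda^{n-1}\mathcal{A}\to\mathfrak{gl}(V)$, $\eta:\mathcal{A}\to\mathfrak{gl}(V)$, $\alpha_V:V\to V$ such that: (1) $(V,\rho,\alpha_V)$ is a representation of the $n$-Hom-Lie superalgebra, i.e. for all homogeneous $x_i,y_j$, writing $|X|=\sum_{k=1}^{n-1}|x_k|$, $|X|^{n-2}=\sum_{k=1}^{n-2}|x_k|$, $|Y|^{i}=\sum_{k=1}^{i}|y_k|$, $|Y|=\sum_{k=1}^n|y_k|$, $|Y|_{i+1}=\sum_{k=i+1}^n|y_k|$, $$\rho(\alpha(x_1),\dots,\alpha(x_{n-1}))\rho(y_1,\dots,y_{n-1})-(-1)^{|X||Y|^{n-1}}\rho(\alpha(y_1),\dots,\alpha(y_{n-1}))\rho(x_1,\dots,x_{n-1})$$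 $$=\sum_{i=1}^{n-1}(-1)^{|X||Y|^{i-1}}\rho(\alpha(y_1),\dots,\alpha(y_{i-1}),[x_1,\dots,x_{n-1},y_i],\alpha(y_{i+1}),\dots,\alpha(y_{n-1}))\alpha_V,$$ $$\rho(\alpha(x_1),\dots,\alpha(x_{n-2}),[y_1,\dots,y_n])\alpha_V=\sum_{i=1}^n(-1)^{n-i}(-1)^{|X|^{n-2}(|Y|+|y_i|)+|y_i||Y|_{i+1}}\rho(\alpha(y_1),\dots,\widehat{\alpha(y_i)},\dots,\alpha(y_n))\rho(x_1,\dots,x_{n-2},y_i).$$ (2) $(V,\eta,\alpha_V)$ is a representation of $(\mathcal{A},\mu,\alpha)$: $\eta(\mu(x,y))\alpha_V=\eta(\alpha(x))\eta(y)$ and $\eta(\alpha(x))\eta(y)=(-1)^{|x||y|}\eta(\alpha(y))\eta(x)$. (3) $\eta([x_1,\dots,x_{n-1},y])\alpha_V=\rho(\alpha(x_1),\dots,\alpha(x_{n-1}))\eta(y)-(-1)^{|y||X|}\eta(\alpha(y))\rho(x_1,\dots,x_{n-1})$ and $$\rho(\alpha(x_1),\dots,\alpha(x_{n-2}),\mu(y,z))\alpha_V=(-1)^{|y||X|^{n-2}}\eta(\alpha(y))\rho(x_1,\dots,x_{n-2},z)+(-1)^{|z|(|X|^{n-2}+|y|)}\eta(\alpha(z))\rho(x_1,\dots,x_{n-2},y).$$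
   Formalization: The k-th term of the bracket on A⊕V carries an extra factor (-1)^{n-k}; as printed, without it, the bracket is not super-skew-symmetric unless ρ=0 (e.g. n=2, A=V=K even, zero bracket and product, ρ(x)v=xv, η=0), so the printed equivalence fails. *)

(* Defs.v *)
From HB Require Import structures.
From mathcomp Require Import all_boot all_order all_fingroup all_algebra.

Set Implicit Arguments.
Unset Strict Implicit.
Unset Printing Implicit Defensive.

Import GRing.Theory.
Local Open Scope ring_scope.

(* Z_2 is represented by bool (false = even, true = odd); its addition is
   addb, and a boolean occurring in an exponent of -1 is coerced to nat.
   Homogeneous vectors are always introduced together with a degree p such that
   x \in homog p, so that 0 is homogeneous of both degrees. *)

Record superspace (K : fieldType) := Superspace {
  carrier :> lmodType K;
  homog : bool -> {pred carrier};
  homog_submod : forall p, submod_closed (homog p);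
  homog_add : forall v, exists v0, (v0 \in homog false) && (v - v0 \in homog true);
  homog_cap : forall v, v \in homog false -> v \in homog true -> v = 0
}.
Arguments homog {K} V p : rename.

Section Part.
Variables (K : fieldType) (V : superspace K).
Implicit Types (p q : bool) (v w : V).

Definition part p v : V :=
  let v0 := xchoose (homog_add v) in if p then v - v0 else v0.

Lemma homog0 p : (0 : V) \in homog V p.
Proof. by case: (homog_submod V p). Qed.

Lemma homogD p v w : v \in homog V p -> w \in homog V p -> v + w \in homog V p.
Proof.
case: (homog_submod V p) => _ H Hv Hw.
by move: (H 1 v w Hv Hw); rewrite scale1r.
Qed.

Lemma homogZ p a v : v \in homog V p -> a *: v \in homog V p.
Proof.
case: (homog_submod V p) => H0 H Hv.
by move: (H a v 0 Hv H0); rewrite addr0.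
Qed.

Lemma homogB p v w : v \in homog V p -> w \in homog V p -> v - w \in homog V p.
Proof. by move=> Hv Hw; rewrite -scaleN1r homogD ?homogZ. Qed.

Lemma part_homog p v : part p v \in homog V p.
Proof. by rewrite /part; case/andP: (xchooseP (homog_add v)); case: p. Qed.

Lemma part_sum v : part false v + part true v = v.
Proof. by rewrite /part addrC subrK. Qed.

Lemma part_unique v v0 v1 :
    v0 \in homog V false -> v1 \in homog V true -> v = v0 + v1 ->
  part false v = v0 /\ part true v = v1.
Proof.
move=> H0 H1 e.
have e0 : part false v - v0 = v1 - part true v.
  by apply/eqP; rewrite subr_eq addrAC eq_sym subr_eq part_sum e addrC.
have z : part false v - v0 = 0.
  apply: homog_cap; first by rewrite homogB ?part_homog.
  by rewrite e0 homogB ?part_homog.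
split; first by apply/eqP; rewrite -subr_eq0 z.
by apply/eqP; rewrite eq_sym -subr_eq0 -e0 z.
Qed.

Lemma part_of_homog p q v :
  v \in homog V p -> part q v = if q == p then v else 0.
Proof.
case: p => Hv.
  have [|E0 E1] := @part_unique v 0 v (homog0 false) Hv; first by rewrite add0r.
  by case: q.
have [|E0 E1] := @part_unique v v 0 Hv (homog0 true); first by rewrite addr0.
by case: q.
Qed.

End Part.

Section DirectSum.
Variables (K : fieldType) (A V : superspace K).

Definition sum_homog (p : bool) : {pred (A * V)%type} :=
  [pred w | (w.1 \in homog A p) && (w.2 \in homog V p)].

Lemma sum_homog_submod p : submod_closed (sum_homog p).
Proof.
split; first by rewrite !inE !homog0.
move=> a [x1 u1] [x2 u2]; rewrite !inE /= => /andP[? ?] /andP[? ?].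
by rewrite !homogD ?homogZ.
Qed.

Lemma sum_homog_add (w : A * V) :
  exists w0, (w0 \in sum_homog false) && (w - w0 \in sum_homog true).
Proof.
exists (part false w.1, part false w.2); case: w => x u /=.
have partB (B : superspace K) (b : B) : b - part false b \in homog B true.
  by rewrite -{1}(part_sum b) addrC addKr part_homog.
by apply/andP; split; apply/andP; split; rewrite ?partB /= ?(part_homog false).
Qed.

Lemma sum_homog_cap (w : A * V) :
  w \in sum_homog false -> w \in sum_homog true -> w = 0.
Proof.
case: w => x u; rewrite !inE /= => /andP[? ?] /andP[? ?].
by congr (_, _); apply: homog_cap.
Qed.

Definition dsum : superspace K :=
  @Superspace K (A * V)%type sum_homog
    sum_homog_submod sum_homog_add sum_homog_cap.

End DirectSum.

Section Sequences.
Variables (T U : Type) (m : nat).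

Definition fmap (f : T -> U) (x : {ffun 'I_m -> T}) : {ffun 'I_m -> U} :=
  [ffun i => f (x i)].

(* x_1, ..., x_(i-1), u, x_(i+1), ..., x_m *)
Definition upd (x : {ffun 'I_m -> T}) (i : 'I_m) (u : T) : {ffun 'I_m -> T} :=
  [ffun j => if j == i then u else x j].

(* x_1, ..., x_(m-1), y *)
Definition snoc (x : {ffun 'I_m.-1 -> T}) (y : T) : {ffun 'I_m -> T} :=
  [ffun i : 'I_m => if insub (i : nat) is Some j then x j else y].

(* x_1, ..., x_(k-1), x_(k+1), ..., x_m *)
Definition omit (k : 'I_m) (x : {ffun 'I_m -> T}) : {ffun 'I_m.-1 -> T} :=
  [ffun i => x (lift k i)].

Definition swap (i j : 'I_m) (x : {ffun 'I_m -> T}) : {ffun 'I_m -> T} :=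
  [ffun k => x (tperm i j k)].

End Sequences.

Section SuperSkew.
Variables (K : fieldType) (A : superspace K).

Definition homogs m (s : 'I_m -> bool) (x : {ffun 'I_m -> A}) : Prop :=
  forall i, x i \in homog A (s i).

Definition multilinear m (W : lmodType K) (f : {ffun 'I_m -> A} -> W) : Prop :=
  forall x i, linear (fun u => f (upd x i u)).

Definition super_skew m (W : lmodType K) (f : {ffun 'I_m -> A} -> W) : Prop :=
  forall (s : 'I_m -> bool) x (i j : 'I_m), homogs s x -> j = i.+1 :> nat ->
    f x = - ((-1) ^+ (s i * s j) *: f (swap i j x)).

End SuperSkew.

Section EvenMaps.
Variables (K : fieldType) (A V : superspace K).

Definition even_linear (f : V -> V) : Prop :=
  linear f /\ forall p v, v \in homog V p -> f v \in homog V p.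

Definition even_bilinear (f : V -> V -> V) : Prop :=
  [/\ forall v, linear (f v), forall w, linear (f^~ w)
    & forall p q v w, v \in homog V p -> w \in homog V q ->
        f v w \in homog V (p (+) q)].

Definition even_multilinear m (f : {ffun 'I_m -> V} -> V) : Prop :=
  multilinear f /\
  forall s x, homogs s x ->
    f x \in homog V (odd (\sum_(i < m) s i)).

(* gl(V) is {linear V -> V}, graded as usual: an endomorphism of degree p
   maps V_q to V_(p + q). *)

Definition even_linear_gl (eta : A -> {linear V -> V}) : Prop :=
  (forall v, linear (fun x => eta x v)) /\
  forall p q x v, x \in homog A p -> v \in homog V q ->
    eta x v \in homog V (p (+) q).

Definition even_exterior_gl m (rho : {ffun 'I_m -> A} -> {linear V -> V}) :
    Prop :=
  [/\ forall v, multilinear (fun x => rho x v),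
      forall v, super_skew (fun x => rho x v)
    & forall s q x v, homogs s x -> v \in homog V q ->
        rho x v \in homog V (odd (\sum_(i < m) s i) (+) q)].

End EvenMaps.

Section Algebras.
Variables (K : fieldType) (A : superspace K) (n : nat).
Variables (br : {ffun 'I_n -> A} -> A) (mu : A -> A -> A) (al : A -> A).

Record is_comm_hom_assoc : Prop := {
  hass_al : even_linear al;
  hass_mu : even_bilinear mu;
  hass_assoc : forall p q r x y z,
    x \in homog A p -> y \in homog A q -> z \in homog A r ->
    mu (mu x y) (al z) = mu (al x) (mu y z);
  hass_comm : forall p q x y, x \in homog A p -> y \in homog A q ->
    mu x y = (-1) ^+ (p * q) *: mu y x
}.

Record is_hom_lie : Prop := {
  hlie_al : even_linear al;
  hlie_br : even_multilinear br;
  hlie_skew : super_skew br;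
  hlie_jacobi : forall (s : 'I_n.-1 -> bool) (t : 'I_n -> bool) x y,
    homogs s x -> homogs t y ->
    br (snoc (fmap al x) (br y)) =
    \sum_(i < n)
      (-1) ^+ ((\sum_(k < n.-1) s k) * (\sum_(k < n | (k < i)%N) t k))
        *: br (upd (fmap al y) i (br (snoc x (y i))))
}.

Record is_hom_nambu_poisson : Prop := {
  hnp_assoc : is_comm_hom_assoc;
  hnp_lie : is_hom_lie;
  hnp_leibniz : forall (s : 'I_n.-1 -> bool) q r x y z,
    homogs s x -> y \in homog A q -> z \in homog A r ->
    br (snoc (fmap al x) (mu y z)) =
      (-1) ^+ (q * \sum_(k < n.-1) s k) *: mu (al y) (br (snoc x z))
      + mu (br (snoc x y)) (al z)
}.

End Algebras.

Section Representations.
Variables (K : fieldType) (A : superspace K) (n : nat).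
Variables (br : {ffun 'I_n -> A} -> A) (mu : A -> A -> A) (al : A -> A).
Variables (V : superspace K).
Variables (rho : {ffun 'I_n.-1 -> A} -> {linear V -> V}).
Variables (eta : A -> {linear V -> V}) (alV : V -> V).

Record is_hom_lie_rep : Prop := {
  hlrep_alV : even_linear alV;
  hlrep_rho : even_exterior_gl rho;
  hlrep_comm : forall (s t : 'I_n.-1 -> bool) x y v,
    homogs s x -> homogs t y ->
    rho (fmap al x) (rho y v)
    - (-1) ^+ ((\sum_(k < n.-1) s k) * (\sum_(k < n.-1) t k))
        *: rho (fmap al y) (rho x v) =
    \sum_(i < n.-1)
      (-1) ^+ ((\sum_(k < n.-1) s k) * (\sum_(k < n.-1 | (k < i)%N) t k))
        *: rho (upd (fmap al y) i (br (snoc x (y i)))) (alV v);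
  hlrep_br : forall (s : 'I_n.-2 -> bool) (t : 'I_n -> bool) x y v,
    homogs s x -> homogs t y ->
    rho (snoc (fmap al x) (br y)) (alV v) =
    \sum_(i < n)
      ((-1) ^+ (n - i.+1)
       * (-1) ^+ ((\sum_(k < n.-2) s k) * ((\sum_(k < n) t k) + t i)
                  + t i * \sum_(k < n | (i < k)%N) t k))
        *: rho (omit i (fmap al y)) (rho (snoc x (y i)) v)
}.

Record is_hom_assoc_rep : Prop := {
  harep_alV : even_linear alV;
  harep_eta : even_linear_gl eta;
  harep_mu : forall p q x y v, x \in homog A p -> y \in homog A q ->
    eta (mu x y) (alV v) = eta (al x) (eta y v);
  harep_comm : forall p q x y v, x \in homog A p -> y \in homog A q ->
    eta (al x) (eta y v) = (-1) ^+ (p * q) *: eta (al y) (eta x v)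
}.

Record is_hom_nambu_poisson_rep : Prop := {
  hnprep_lie : is_hom_lie_rep;
  hnprep_assoc : is_hom_assoc_rep;
  hnprep_br : forall (s : 'I_n.-1 -> bool) q x y v,
    homogs s x -> y \in homog A q ->
    eta (br (snoc x y)) (alV v) =
      rho (fmap al x) (eta y v)
      - (-1) ^+ (q * \sum_(k < n.-1) s k) *: eta (al y) (rho x v);
  hnprep_mu : forall (s : 'I_n.-2 -> bool) q r x y z v,
    homogs s x -> y \in homog A q -> z \in homog A r ->
    rho (snoc (fmap al x) (mu y z)) (alV v) =
      (-1) ^+ (q * \sum_(k < n.-2) s k) *: eta (al y) (rho (snoc x z) v)
      + (-1) ^+ (r * ((\sum_(k < n.-2) s k) + q))
          *: eta (al z) (rho (snoc x y) v)
}.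

End Representations.

Section SemidirectProduct.
Variables (K : fieldType) (A V : superspace K) (n : nat).
Variables (br : {ffun 'I_n -> A} -> A) (mu : A -> A -> A) (al : A -> A).
Variables (rho : {ffun 'I_n.-1 -> A} -> {linear V -> V}).
Variables (eta : A -> {linear V -> V}) (alV : V -> V).

Definition sum_al (w : dsum A V) : dsum A V := (al w.1, alV w.2).

(* The formulas below involve degrees, hence make sense for homogeneous
   arguments; sum_mu and sum_br are their (multi)linear extensions, obtained by
   splitting every argument into its homogeneous components
   (see sum_muE and sum_brE). *)

Definition sum_mu_homog (p q : bool) (w z : dsum A V) : dsum A V :=
  (mu w.1 z.1, eta w.1 z.2 + (-1) ^+ (q * p) *: eta z.1 w.2).

Definition sum_mu (w z : dsum A V) : dsum A V :=
  \sum_p \sum_q sum_mu_homog p q (part p w) (part q z).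

(* Moving x_k + a_k to the last position of a super-skew-symmetric bracket
   costs (-1)^(n-k) (-1)^(|x_k| (|x_(k+1)| + ... + |x_n|)). *)
Definition sum_br_homog (s : 'I_n -> bool) (w : {ffun 'I_n -> dsum A V}) :
    dsum A V :=
  let x : {ffun 'I_n -> A} := fmap fst w in
  (br x,
   \sum_(k < n)
     ((-1) ^+ (n - k.+1) * (-1) ^+ (s k * \sum_(l < n | (k < l)%N) s l))
       *: rho (omit k x) (w k).2).

Definition sum_br (w : {ffun 'I_n -> dsum A V}) : dsum A V :=
  \sum_(s : {ffun 'I_n -> bool}) sum_br_homog s [ffun i => part (s i) (w i)].

Lemma sum_muE p q w z :
    even_bilinear mu -> even_linear_gl eta ->
    w \in homog (dsum A V) p -> z \in homog (dsum A V) q ->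
  sum_mu w z = sum_mu_homog p q w z.
Proof.
move=> [muL muR _] [etaL _] Hw Hz.
have lin0 (U W : lmodType K) (f : U -> W) : linear f -> f 0 = 0.
  by move=> Hf; have := Hf (-1) 0 0; rewrite scaler0 addr0 scaleN1r addNr.
rewrite /sum_mu (bigD1 p) //= (bigD1 q) //= big1 ?addr0 => [|q' nq]; last first.
  rewrite (part_of_homog q' Hz) (negPf nq) /sum_mu_homog /=.
  by rewrite (lin0 _ _ _ (muL _)) linear0 (lin0 _ _ _ (etaL _)) scaler0 addr0.
rewrite big1 ?addr0 => [|p' np]; last first.
  rewrite big1 // => q' _.
  rewrite (part_of_homog p' Hw) (negPf np) /sum_mu_homog /=.
  by rewrite (lin0 _ _ _ (muR _)) linear0 (lin0 _ _ _ (etaL _)) scaler0 addr0.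
by rewrite (part_of_homog p Hw) (part_of_homog q Hz) !eqxx.
Qed.

Lemma sum_brE (s : 'I_n -> bool) w :
    even_multilinear br -> even_exterior_gl rho ->
    homogs s w ->
  sum_br w = sum_br_homog s w.
Proof.
move=> [brL _] [rhoL _ _] Hw.
have ml0 (B : superspace K) m (W : lmodType K) (f : {ffun 'I_m -> B} -> W)
      (x : {ffun 'I_m -> B}) (i : 'I_m) :
    multilinear f -> x i = 0 -> f x = 0.
  move=> Hf x0; have := Hf x i (-1) 0 0.
  rewrite scaler0 addr0 scaleN1r addNr => <-; congr f.
  by apply/ffunP => j; rewrite ffunE; case: eqP => // ->.
pose s' : {ffun 'I_n -> bool} := [ffun i => s i].
rewrite /sum_br (bigD1 s') //= big1 ?addr0 => [|t nt].
  have -> : [ffun i => part (s' i) (w i)] = w.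
    by apply/ffunP => i; rewrite !ffunE (part_of_homog _ (Hw i)) eqxx.
  rewrite /sum_br_homog; congr (_, _); apply: eq_bigr => k _.
  by rewrite ffunE; under eq_bigr do rewrite ffunE.
have [i ti] : exists i, t i != s i.
  apply/existsP; rewrite -negb_forall; apply: contraNN nt => /forallP e.
  by apply/eqP/ffunP => i; rewrite ffunE; apply/eqP.
have w0 : [ffun i => part (t i) (w i)] i = 0 :> dsum A V.
  by rewrite ffunE (part_of_homog _ (Hw i)) (negPf ti).
congr (_, _); first by apply: (ml0 _ _ _ _ _ i brL); rewrite ffunE w0.
rewrite big1 // => k _.
have [-> | ik] := eqVneq k i; first by rewrite w0 linear0 scaler0.
have [j e _] := unlift_some ik.
by rewrite (ml0 _ _ _ _ _ j (rhoL _)) ?scaler0 // !ffunE -e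
           -[part _ _](ffunE (fun i => part (t i) (w i))) w0.
Qed.

End SemidirectProduct.

(* Main.v *)
Require Import Defs.
From mathcomp Require Import all_boot all_order all_fingroup all_algebra.
From mathcomp Require Import ssrAC zify.

(** Every axiom of the semidirect product on A + V compares two expressions that
    are linear in each argument and in which a product of two elements of V is
    zero.  Its A-component is the same axiom for A.  Its V-component is a sum of
    terms each containing exactly one vector of V, so it can be sorted according
    to the argument that this vector comes from.  The terms containing the
    vector of a given argument add up, with a common sign, to the difference of
    the two sides of one axiom of a representation, called a defect below:

    - in the Hom-Jacobi identity for [x_1, .., x_(n-1), [y_1, .., y_n]], a vector
      in place of y_k gives the defect of the commutator formula for rho at
      (x; y without y_k), and a vector in place of x_m gives the defect of the
      formula for rho(.., [y_1, .., y_n]) at (x without x_m; y)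
      ([jacobi_defect]);
    - in the Hom-Leibniz identity for [x_1, .., x_(n-1), y z], a vector in place
      of y or z gives the defect of the formula for eta([x, .]), and a vector in
      place of x_m that of the formula for rho(.., y z) ([leibniz_defect]);
    - Hom-associativity gives the two axioms on eta alone
      ([sum_is_comm_hom_assoc]).

    Hence the axioms of a representation imply those of A + V.  Conversely, when
    one argument is taken in V and all the others in A, the sum reduces to a
    single defect up to sign, which must vanish.  This
    treats homogeneous vectors only, but defects are additive in the vector
    ([additive_homog_eq0]).

    Evenness and multilinearity of the operations on A + V follow from those of
    the data, and super-skew-symmetry of the bracket from that of rho together
    with the sign (-1)^(n-k) carried by the k-th slot ([sum_br_skew]). *)

Import GRing.Theory.
Local Open Scope ring_scope.

(** All sign rules of the file are identities between polynomial expressions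
    over Z_2 in a few degrees and parities of sums of degrees: the atoms are
    generalized and all their values tried. *)
Ltac parity :=
  rewrite ?(oddD, oddM, oddb);
  repeat match goal with |- context [odd ?m] => move: (odd m) end;
  repeat match goal with |- context [?f ?x] =>
    match type of (f x) with bool =>
      lazymatch f with
      | andb _ => fail | addb _ => fail
      | _ => generalize (f x)
      end
    end
  end;
  intros; repeat match goal with b : bool |- _ => destruct b end; reflexivity.

Ltac sign_eq :=
  do ?rewrite -exprD; rewrite -[LHS]signr_odd -[RHS]signr_odd;
  congr (_ ^+ nat_of_bool _); parity.

(** * Sequences with one slot singled out *)

Section Sequences.
Set Implicit Arguments.
Unset Strict Implicit.

Lemma snoc_lift (T : Type) N (x : {ffun 'I_N -> T}) y (i : 'I_N) :
  @snoc T N.+1 x y (lift ord_max i) = x i.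
Proof.
rewrite ffunE; case: insubP => [j _ e | ].
  by congr (x _); apply: val_inj; rewrite e lift_max.
by rewrite lift_max ltn_ord.
Qed.

Lemma snoc_max (T : Type) N (x : {ffun 'I_N -> T}) y : @snoc T N.+1 x y ord_max = y.
Proof. by rewrite ffunE insubN //= ltnn. Qed.

Lemma fmap_snoc (T U : Type) N (f : T -> U) (x : {ffun 'I_N -> T}) y :
  fmap f (@snoc T N.+1 x y) = @snoc U N.+1 (fmap f x) (f y).
Proof.
apply/ffunP => i; rewrite ffunE; case: (unliftP ord_max i) => [j|] ->.
  by rewrite !snoc_lift ffunE.
by rewrite !snoc_max.
Qed.

Lemma fmap_upd (T U : Type) N (f : T -> U) (x : {ffun 'I_N -> T}) i y :
  fmap f (upd x i y) = upd (fmap f x) i (f y).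
Proof. by apply/ffunP => j; rewrite !ffunE; case: eqP. Qed.

Lemma fmap_omit (T U : Type) N (f : T -> U) (x : {ffun 'I_N -> T}) k :
  fmap f (omit k x) = omit k (fmap f x).
Proof. by apply/ffunP => j; rewrite !ffunE. Qed.

Lemma fmap_swap (T U : Type) N (f : T -> U) (x : {ffun 'I_N -> T}) i j :
  fmap f (swap i j x) = swap i j (fmap f x).
Proof. by apply/ffunP => k; rewrite !ffunE. Qed.

Lemma upd_same (T : Type) N (x : {ffun 'I_N -> T}) i y : upd x i y i = y.
Proof. by rewrite ffunE eqxx. Qed.

Lemma upd_lift (T : Type) N (x : {ffun 'I_N.+1 -> T}) k i y :
  upd x k y (lift k i) = x (lift k i).
Proof. by rewrite ffunE eq_sym (negPf (neq_lift _ _)). Qed.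

Lemma upd_lift_at (T : Type) N (x : {ffun 'I_N.+1 -> T}) k i y :
  upd x (lift k i) y k = x k.
Proof. by rewrite ffunE (negPf (neq_lift _ _)). Qed.

Lemma omit_upd (T : Type) N (x : {ffun 'I_N.+1 -> T}) k y :
  omit k (upd x k y) = omit k x.
Proof. by apply/ffunP => j; rewrite [LHS]ffunE upd_lift ffunE. Qed.

Lemma omit_upd_lift (T : Type) N (x : {ffun 'I_N.+1 -> T}) k i y :
  omit k (upd x (lift k i) y) = upd (omit k x) i y.
Proof. by apply/ffunP => j; rewrite !ffunE (inj_eq lift_inj). Qed.

Lemma omit_max_snoc (T : Type) N (x : {ffun 'I_N -> T}) y :
  omit ord_max (@snoc T N.+1 x y) = x.
Proof. by apply/ffunP => j; rewrite ffunE snoc_lift. Qed.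

Lemma omit_lift_snoc (T : Type) N (x : {ffun 'I_N.+1 -> T}) m y :
  omit (lift ord_max m) (@snoc T N.+2 x y) = @snoc T N.+1 (omit m x) y.
Proof.
apply/ffunP => j; rewrite ffunE; case: (unliftP ord_max j) => [i|] ->.
  rewrite (@snoc_lift T N) [RHS]ffunE.
  suff -> : lift (lift ord_max m) (lift ord_max i) = lift ord_max (lift m i).
    by rewrite snoc_lift.
  apply: val_inj.
  change (bump (lift ord_max m) (lift ord_max i) = lift ord_max (lift m i)).
  by rewrite !lift_max.
rewrite (@snoc_max T N).
suff -> : lift (lift ord_max m) ord_max = ord_max :> 'I_N.+2 by rewrite snoc_max.
apply: val_inj; change (bump (lift ord_max m) N = N.+1).
by rewrite lift_max /bump -ltnS ltn_ord.
Qed.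

End Sequences.

(** * Sums over slots and partial sums of degrees *)

Section Sums.
Set Implicit Arguments.
Unset Strict Implicit.

Lemma sum_neq_lift (W : nmodType) N (k : 'I_N.+1) (F : 'I_N.+1 -> W) :
  \sum_(i < N.+1 | i != k) F i = \sum_(i < N) F (lift k i).
Proof.
rewrite big_mkcond (bigD1_ord k) //= eqxx add0r; apply: eq_bigr => i _.
by rewrite eq_sym neq_lift.
Qed.

(** Enumerates the pairs of distinct slots from either member.  In the
    Hom-Jacobi identity one member is the slot filled by an inner bracket, the
    other the slot of the vector in V: the axiom sums over the former first,
    while a defect is attached to the latter. *)
Lemma exchange_lift (W : nmodType) N (F : 'I_N.+1 -> 'I_N.+1 -> W) :
  \sum_(i < N.+1) \sum_(k < N) F i (lift i k) =
  \sum_(k < N.+1) \sum_(i < N) F (lift k i) k.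
Proof.
under eq_bigr do rewrite -(sum_neq_lift _ (F _)).
under [RHS]eq_bigr do rewrite -(sum_neq_lift _ (F^~ _)).
rewrite (exchange_big_dep xpredT) //=; apply: eq_bigr => k _.
by apply: eq_bigl => i; rewrite eq_sym.
Qed.

Variables (N : nat).

Lemma sum_snoc (s : 'I_N -> bool) q :
  (\sum_(k < N.+1) (@snoc _ N.+1 (finfun s) q) k = \sum_(k < N) s k + q)%N.
Proof.
rewrite (bigD1_ord ord_max) //= snoc_max addnC; congr (_ + _)%N.
by apply: eq_bigr => i _; rewrite snoc_lift ffunE.
Qed.

Lemma sum_gt_snoc (s : 'I_N -> bool) q (m : 'I_N) :
  (\sum_(k < N.+1 | m < k) (@snoc _ N.+1 (finfun s) q) k
   = \sum_(k < N | m < k) s k + q)%N.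
Proof.
rewrite (bigD1_ord ord_max) /= ?ltn_ord // snoc_max addnC; congr (_ + _)%N.
by apply: eq_big => [i|i _]; rewrite ?snoc_lift ?ffunE //
  -[bump N i]/(nat_of_ord (lift ord_max i)) lift_max.
Qed.

Lemma sum_lift (t : 'I_N.+1 -> bool) k :
  (\sum_(l < N.+1) t l = t k + \sum_(l < N) t (lift k l))%N.
Proof. by rewrite (bigD1_ord k). Qed.

Lemma sum_split_at M (t : 'I_M -> bool) (k : 'I_M) :
  (\sum_(l < M) t l =
   \sum_(l < M | l < k) t l + t k + \sum_(l < M | k < l) t l)%N.
Proof.
rewrite (bigD1 k) //= [in RHS]addnAC addnC; congr (_ + _)%N.
rewrite (bigID (fun l : 'I_M => (l < k)%N)) /=; congr (_ + _)%N;
  apply: eq_bigl => l; rewrite -(inj_eq val_inj) /=; by case: ltngtP.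
Qed.

Lemma sum_lt_lift (t : 'I_N.+1 -> bool) (k : 'I_N.+1) (i : 'I_N) :
  (\sum_(l < N.+1 | l < lift k i) t l =
   (k < lift k i)%N * t k + \sum_(l < N | l < i) t (lift k l))%N.
Proof.
rewrite big_mkcond (bigD1_ord k) //= [in RHS]big_mkcond /=; congr (_ + _)%N.
  by case: ltnP; rewrite ?mul1n ?mul0n.
apply: eq_bigr => l _.
by rewrite ltnNge [(_ <= _)%N]leq_bump2 -ltnNge.
Qed.

(** An inner bracket with x in the slot [lift k i] adds the degree [X] of x to
    that slot, which the [k]-th slot feels only if it comes earlier. *)
Lemma sum_gt_upd (t : 'I_N.+1 -> bool) (k : 'I_N.+1) (i : 'I_N) (X : bool) :
  odd (\sum_(l < N.+1 | (k < l)%N) upd (finfun t) (lift k i) (X (+) t (lift k i)) l)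
  = ((k < lift k i)%N && X) (+) odd (\sum_(l < N.+1 | (k < l)%N) t l).
Proof.
rewrite !(big_morph odd oddD (erefl (odd 0))).
rewrite big_mkcond [in RHS]big_mkcond (bigD1 (lift k i)) //=.
rewrite [in RHS](bigD1 (lift k i)) //= addbA.
rewrite upd_same; congr (_ (+) _).
  by case: ltnP; rewrite ?oddb.
by apply: eq_bigr => l /negPf nl; rewrite !ffunE nl.
Qed.

Lemma sum_gt_upd_same (t : 'I_N.+1 -> bool) (k : 'I_N.+1) (q : bool) :
  (\sum_(l < N.+1 | (k < l)%N) upd (finfun t) k q l =
   \sum_(l < N.+1 | (k < l)%N) t l)%N.
Proof.
apply: eq_bigr => l kl; rewrite !ffunE; case: eqP => // e.
by rewrite e ltnn in kl.
Qed.

Lemma sum_lift_split (t : 'I_N.+1 -> bool) (k : 'I_N.+1) :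
  (\sum_(l < N) t (lift k l) =
   \sum_(l < N.+1 | l < k) t l + \sum_(l < N.+1 | k < l) t l)%N.
Proof. by apply: (@addnI (t k)); rewrite -sum_lift (sum_split_at t k) addnCA addnA. Qed.

End Sums.

(** * Linear maps and homogeneous components *)

Section GradedSpaces.
Set Implicit Arguments.
Unset Strict Implicit.
Variables (K : fieldType).

Lemma linear_funD (U W : lmodType K) (f : U -> W) :
  linear f -> {morph f : u v / u + v}.
Proof. by move=> Hf u v; have := Hf 1 u v; rewrite !scale1r. Qed.

Lemma linear_comp (U W Z : lmodType K) (f : U -> W) (g : W -> Z) :
  linear f -> linear g -> linear (fun u => g (f u)).
Proof. by move=> Hf Hg a u v; rewrite Hf Hg. Qed.

Lemma linear_big (U W : lmodType K) (I : Type) (r : seq I) (P : pred I)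
    (f : I -> U -> W) :
  (forall i, linear (f i)) -> linear (fun u => \sum_(i <- r | P i) f i u).
Proof.
move=> Hf a u v; rewrite scaler_sumr -big_split /=.
by apply: eq_bigr => i _; rewrite Hf.
Qed.

Lemma part_linear (V : superspace K) p : linear (part p : V -> V).
Proof.
move=> a u v.
have [] := @part_unique K V (a *: u + v) (a *: part false u + part false v)
  (a *: part true u + part true v).
- by rewrite homogD ?homogZ ?part_homog.
- by rewrite homogD ?homogZ ?part_homog.
- by rewrite addrACA -scalerDr !part_sum.
by case: p.
Qed.

(** The axioms of a representation hold for all vectors of V, those of the
    direct sum are only known for homogeneous ones. *)
Lemma additive_homog_eq0 (V : superspace K) (W : lmodType K) (f : V -> W) :
  {morph f : u v / u + v} ->
  (forall p v, v \in homog V p -> f v = 0) -> forall v, f v = 0.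
Proof.
move=> fD f0 v; rewrite -(part_sum v) fD.
by rewrite (f0 false) ?(f0 true) ?addr0 ?part_homog.
Qed.

Lemma homog_sum (V : superspace K) p (I : Type) (r : seq I) (P : pred I)
    (F : I -> V) :
  (forall i, P i -> F i \in homog V p) -> \sum_(i <- r | P i) F i \in homog V p.
Proof.
move=> HF; apply: (big_ind (fun v => v \in homog V p)) => //.
  exact: homog0.
by move=> u v; apply: homogD.
Qed.

Lemma signr_scaler_eq0 (V : lmodType K) m (v : V) :
  (-1) ^+ m *: v = 0 :> V -> v = 0.
Proof. by move/eqP; rewrite scaler_eq0 signr_eq0 => /eqP. Qed.

Variables (A V : superspace K).

Lemma homog_dsum p (w : dsum A V) :
  (w \in homog (dsum A V) p) = (w.1 \in homog A p) && (w.2 \in homog V p).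
Proof. by []. Qed.

Lemma homogs_snoc (B : superspace K) N (s : 'I_N -> bool) q
    (x : {ffun 'I_N -> B}) y :
  homogs s x -> y \in homog B q ->
  homogs (@snoc _ N.+1 (finfun s) q) (@snoc _ N.+1 x y).
Proof.
move=> Hx Hy i; case: (unliftP ord_max i) => [j|] ->.
  by rewrite !snoc_lift ffunE.
by rewrite !snoc_max.
Qed.

Lemma homogs_upd (B : superspace K) N (s : 'I_N -> bool) q
    (x : {ffun 'I_N -> B}) i y :
  homogs s x -> y \in homog B q -> homogs (upd (finfun s) i q) (upd x i y).
Proof. by move=> Hx Hy j; rewrite !ffunE; case: eqP. Qed.

Lemma homogs_omit (B : superspace K) N (s : 'I_N -> bool)
    (x : {ffun 'I_N -> B}) k :
  homogs s x -> homogs (fun j => s (lift k j)) (omit k x).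
Proof. by move=> Hx j; rewrite ffunE. Qed.

Lemma homogs_fmap (B C : superspace K) N (s : 'I_N -> bool) (f : B -> C)
    (x : {ffun 'I_N -> B}) :
  (forall p v, v \in homog B p -> f v \in homog C p) ->
  homogs s x -> homogs s (fmap f x).
Proof. by move=> Hf Hx i; rewrite ffunE Hf. Qed.

Lemma homogs_fst N (s : 'I_N -> bool) (w : {ffun 'I_N -> dsum A V}) :
  homogs s w -> homogs s (fmap (@fst A V) w).
Proof. by move=> Hw i; rewrite ffunE; case/andP: (Hw i). Qed.

Lemma homogs_base N (s : 'I_N -> bool) (x : {ffun 'I_N -> A}) :
  homogs s x -> homogs s (fmap (fun u => (u, 0) : dsum A V) x).
Proof. by apply: homogs_fmap => p v Hv; rewrite homog_dsum /= Hv homog0. Qed.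

End GradedSpaces.

(** * The operations of the semidirect product *)

Section SemidirectOperations.
Set Implicit Arguments.
Unset Strict Implicit.
Variables (K : fieldType) (A V : superspace K) (N : nat).
Variables (br : {ffun 'I_N.+1 -> A} -> A) (mu : A -> A -> A) (al : A -> A).
Variables (rho : {ffun 'I_N -> A} -> {linear V -> V}).
Variables (eta : A -> {linear V -> V}) (alV : V -> V).
Hypotheses (Hal : even_linear al) (Hmu : even_bilinear mu).
Hypotheses (Hbr : even_multilinear br) (skew_br : super_skew br).
Hypotheses (Hrho : even_exterior_gl rho) (Heta : even_linear_gl eta).
Hypotheses (HalV : even_linear alV).

Local Notation W := (dsum A V).
Local Notation base := (fmap (@fst A V)).
Local Notation Br := (@sum_br K A V N.+1 br rho).
Local Notation Mu := (sum_mu mu eta).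
Local Notation Al := (sum_al al alV).

Lemma sum_al_even : even_linear (Al : W -> W).
Proof.
case: Hal => alL alH; case: HalV => alVL alVH; split.
  by move=> a [x u] [y v]; rewrite /sum_al /= alL alVL.
by move=> p [x u]; rewrite !homog_dsum /= => /andP[/alH-> /alVH->].
Qed.

Lemma sum_mu_even : even_bilinear Mu.
Proof.
have [muL muR muH] := Hmu; have [etaL etaH] := Heta.
have muP a x y w : mu (a *: x + y) w = a *: mu x w + mu y w := muR w a x y.
have etaP a x y v : eta (a *: x + y) v = a *: eta x v + eta y v := etaL v a x y.
split=> [v|w|p q v w Hv Hw].
- apply: linear_big => p; apply: linear_big => q.
  apply: (linear_comp (g := sum_mu_homog mu eta p q (part (V:=W) p v))
    (part_linear (V:=W) q)) => a x y.
  apply: injective_projections; rewrite /= ?muL // linearP etaP !scalerDr addrACA.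
  by rewrite !scalerA mulrC.
- apply: linear_big => p; apply: linear_big => q.
  apply: (linear_comp (g := (sum_mu_homog mu eta p q)^~ (part (V:=W) q w))
    (part_linear (V:=W) p)) => a x y.
  apply: injective_projections; rewrite /= ?muP // linearP etaP !scalerDr addrACA.
  by rewrite !scalerA mulrC.
rewrite (sum_muE Hmu Heta Hv Hw) homog_dsum /=.
case/andP: Hv => Hv1 Hv2; case/andP: Hw => Hw1 Hw2.
rewrite muH //= homogD ?homogZ //; first exact: etaH.
by rewrite addbC etaH.
Qed.

(** The Koszul sign for moving the [k]-th argument to the last place of a
    super-skew-symmetric bracket. *)
Definition slot_sign (s : 'I_N.+1 -> bool) (k : 'I_N.+1) : K :=
  (-1) ^+ (N.+1 - k.+1) * (-1) ^+ (s k * \sum_(l < N.+1 | (k < l)%N) s l).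

Lemma sum_br_fst s w : homogs s w -> (Br w).1 = br (base w).
Proof. by move=> Hw; rewrite (sum_brE Hbr Hrho Hw). Qed.

Lemma sum_br_snd s w : homogs s w ->
  (Br w).2 = \sum_k slot_sign s k *: rho (omit k (base w)) (w k).2.
Proof. by move=> Hw; rewrite (sum_brE Hbr Hrho Hw). Qed.

Lemma sum_br_homog_multilinear s :
  multilinear (fun w : {ffun 'I_N.+1 -> W} => sum_br_homog br rho s w : W).
Proof.
move=> x i a u v; have [rhoL _ _] := Hrho; have [brL _] := Hbr.
have rhoP x' i' a' u' v' z : rho (upd x' i' (a' *: u' + v')) z =
    a' *: rho (upd x' i' u') z + rho (upd x' i' v') z := rhoL z x' i' a' u' v'.
apply: injective_projections => /=; first by rewrite !fmap_upd /= [LHS]brL.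
rewrite scaler_sumr -big_split /=; apply: eq_bigr => k _; rewrite !fmap_upd /=.
move: ((-1) ^+ _ * _) => c; rewrite scalerA mulrC -scalerA -scalerDr; congr (_ *: _).
case: (unliftP k i) => [j|] ->.
  by rewrite !upd_lift_at !omit_upd_lift rhoP.
by rewrite !upd_same !omit_upd linearP.
Qed.

Lemma sum_br_even : even_multilinear Br.
Proof.
split=> [x i|s w Hw].
  apply: linear_big => s a u v.
  have E y : [ffun j => part (V:=W) (s j) (upd x i y j)] =
      upd [ffun j => part (V:=W) (s j) (x j)] i (part (V:=W) (s i) y).
    by apply/ffunP => j; rewrite !ffunE; case: eqP => [->|].
  by rewrite !E part_linear sum_br_homog_multilinear.
have [_ brH] := Hbr; have [_ _ rhoH] := Hrho.
rewrite homog_dsum (sum_br_fst Hw) (sum_br_snd Hw) brH /=; last exact: homogs_fst.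
apply: homog_sum => k _; apply: homogZ.
have /andP[_ Hk] : w k \in homog W (s k) by [].
have := rhoH _ _ _ _ (homogs_omit k (homogs_fst Hw)) Hk.
by rewrite (sum_lift _ k) oddD oddb addbC.
Qed.

Lemma sum_gt_succ (t : 'I_N.+1 -> bool) (i j : 'I_N.+1) : j = i.+1 :> nat ->
  (\sum_(l < N.+1 | i < l) t l = t j + \sum_(l < N.+1 | j < l) t l)%N.
Proof.
move=> ij; rewrite (bigD1 j) ?ij //=; congr (_ + _)%N; apply: eq_bigl => l.
by rewrite -(inj_eq val_inj) /= ij; lia.
Qed.

Lemma omit_swap (T : Type) (x : {ffun 'I_N.+1 -> T}) (i j : 'I_N.+1) :
  j = i.+1 :> nat ->
  omit j (swap i j x) = omit i x /\ omit i (swap i j x) = omit j x.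
Proof.
move=> ij.
have bumpE (h m : nat) : bump h m = if (h <= m)%N then m.+1 else m.
  by rewrite /bump; case: leqP.
split; apply/ffunP => m; rewrite !ffunE; congr (x _); apply: val_inj => /=;
  case: tpermP => [/(congr1 val)|/(congr1 val)|/eqP + /eqP +];
  by rewrite -?(inj_eq val_inj) /= !bumpE ij; do 2 case: leqP => ?; lia.
Qed.

Lemma swap_lift (T : Type) (x : {ffun 'I_N.+1 -> T}) (k : 'I_N.+1) i j :
  omit k (swap (lift k i) (lift k j) x) = swap i j (omit k x).
Proof.
apply/ffunP => m; rewrite !ffunE; congr (x _).
by case: tpermP => [/lift_inj->|/lift_inj->|n1 n2];
  rewrite ?tpermL ?tpermR ?tpermD //; apply/eqP => e; [apply: n1|apply: n2]; rewrite e.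
Qed.

(** A transposition of adjacent arguments either takes place inside the
    arguments of [rho], or it displaces the vector of V by one slot: then the
    minus sign comes from the factor (-1)^(n-k) of the slot sign. *)
Lemma sum_br_skew : super_skew Br.
Proof.
move=> s w i j Hw ij; have [_ skew_rho _] := Hrho.
pose s' k := s (tperm i j k).
have Hw' : homogs s' (swap i j w) by move=> k; rewrite ffunE.
have Hx : homogs s (base w) := homogs_fst Hw.
apply: injective_projections => /=.
  by rewrite (sum_br_fst Hw) (sum_br_fst Hw') fmap_swap (skew_br Hx ij).
rewrite (sum_br_snd Hw) (sum_br_snd Hw') scaler_sumr -sumrN fmap_swap.
(* Now both sides are sums over the slot k that the vector has in w. *)
rewrite [RHS](reindex_inj (@perm_inj _ (tperm i j))) /=.
apply: eq_bigr => k _; rewrite [swap i j w _]ffunE tpermK scalerA -scaleNr.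
have ltN : (j < N.+1)%N by [].
have tail : (\sum_(l < N.+1 | j < l) s' l = \sum_(l < N.+1 | j < l) s l)%N.
  apply: eq_bigr => l jl; rewrite /s' tpermD // -(inj_eq val_inj) /=; lia.
have [oj oi] := omit_swap (base w) ij.
have sub_ij : (N.+1 - i.+1 = (N.+1 - j.+1).+1)%N by lia.
have [-> | ki] := eqVneq k i.
  rewrite tpermL oj /slot_sign tail /s' tpermR (sum_gt_succ s ij) sub_ij.
  rewrite exprS mulN1r mulNr; congr (- _ *: _).
  by sign_eq.
have [-> | kj] := eqVneq k j.
  rewrite tpermR oi /slot_sign (sum_gt_succ _ ij) tail /s' tpermR tpermL sub_ij.
  rewrite exprS mulN1r mulNr mulrN opprK; congr (_ *: _).
  by sign_eq.
have [i' ei _] := unlift_some ki; have [j' ej _] := unlift_some kj.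
have ij' : j' = i'.+1 :> nat.
  by move: ij; rewrite ei ej /= /bump; do 2 case: leqP; lia.
rewrite tpermD 1?eq_sym // ei ej swap_lift -ei -ej.
rewrite (skew_rho _ _ _ _ _ (homogs_omit k Hx) ij') -ei -ej.
rewrite scalerN scaleNr !scalerA mulrC; congr (- (_ * _ *: _)).
rewrite /slot_sign /s' tpermD 1?eq_sym //; congr (_ * (-1) ^+ (_ * _)).
rewrite [RHS](reindex_inj (@perm_inj _ (tperm i j))) /=.
apply: eq_big => [l|l _]; last by rewrite tpermK.
case: tpermP => // ->; move: ki kj; rewrite -!(inj_eq val_inj) /=; lia.
Qed.

End SemidirectOperations.

(** * Defects of the representation axioms *)

Section Defects.
Set Implicit Arguments.
Unset Strict Implicit.
Variables (K : fieldType) (A V : superspace K) (N : nat).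
Variables (br : {ffun 'I_N.+2 -> A} -> A) (mu : A -> A -> A) (al : A -> A).
Variables (rho : {ffun 'I_N.+1 -> A} -> {linear V -> V}).
Variables (eta : A -> {linear V -> V}) (alV : V -> V).
Hypotheses (Hal : even_linear al) (Hmu : even_bilinear mu).
Hypotheses (Hbr : even_multilinear br).
Hypotheses (Hrho : even_exterior_gl rho) (Heta : even_linear_gl eta).
Hypotheses (HalV : even_linear alV).

Local Notation W := (dsum A V).
Local Notation base := (fmap (@fst A V)).
Local Notation Br := (@sum_br K A V N.+2 br rho).
Local Notation Mu := (sum_mu mu eta).
Local Notation Al := (sum_al al alV).
Local Notation snocA := (@snoc A N.+2).
Local Notation snocV := (@snoc W N.+2).

(** The last argument is given degree 0 here because a bracket [x_1, .., x_(n-1),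
    y] occurs with several y; [slot_sign_snoc] restores its degree. *)
Definition arg_sign (s : 'I_N.+1 -> bool) (m : 'I_N.+1) : K :=
  slot_sign K (@snoc _ N.+2 (finfun s) false) (lift ord_max m).

Lemma slot_sign_snoc (s : 'I_N.+1 -> bool) q m :
  slot_sign K (@snoc _ N.+2 (finfun s) q) (lift ord_max m) =
  (-1) ^+ (s m * q) * arg_sign s m.
Proof.
rewrite /arg_sign /slot_sign !snoc_lift !ffunE lift_max !sum_gt_snoc.
by sign_eq.
Qed.

Lemma slot_sign_max (s : 'I_N.+1 -> bool) q :
  slot_sign K (@snoc _ N.+2 (finfun s) q) ord_max = 1.
Proof.
rewrite /slot_sign subnn mul1r big_pred0 ?muln0 // => l.
by rewrite ltnNge -ltnS ltn_ord.
Qed.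

Lemma sum_br_snoc s q (w : {ffun 'I_N.+1 -> W}) (z : W) :
  homogs s w -> z \in homog W q ->
  (Br (snocV w z)).2 =
  \sum_(m < N.+1) ((-1) ^+ (s m * q) * arg_sign s m)
     *: rho (@snoc _ N.+1 (omit m (base w)) z.1) (w m).2
  + rho (base w) z.2.
Proof.
move=> Hw Hz; rewrite (sum_br_snd Hbr Hrho (homogs_snoc Hw Hz)).
rewrite (bigD1_ord ord_max) //= addrC fmap_snoc omit_max_snoc snoc_max.
rewrite slot_sign_max scale1r; congr (_ + _); apply: eq_bigr => m _.
by rewrite slot_sign_snoc omit_lift_snoc snoc_lift.
Qed.

(** The axioms of a representation are handled as differences of their two sides:
    these are additive in the vector [v], hence vanish at 0, so that a signed sum
    of them can be cut down to the term of a single slot. *)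
Definition comm_defect (s t : 'I_N.+1 -> bool) x y v : V :=
  rho (fmap al x) (rho y v)
  - (-1) ^+ ((\sum_(k < N.+1) s k) * (\sum_(k < N.+1) t k))
      *: rho (fmap al y) (rho x v)
  - \sum_(i < N.+1)
      (-1) ^+ ((\sum_(k < N.+1) s k) * (\sum_(k < N.+1 | (k < i)%N) t k))
        *: rho (upd (fmap al y) i (br (snocA x (y i)))) (alV v).

Definition br_defect (s : 'I_N -> bool) (t : 'I_N.+2 -> bool) x y v : V :=
  rho (@snoc _ N.+1 (fmap al x) (br y)) (alV v)
  - \sum_(i < N.+2)
      ((-1) ^+ (N.+2 - i.+1)
       * (-1) ^+ ((\sum_(k < N) s k) * ((\sum_(k < N.+2) t k) + t i)
                  + t i * \sum_(k < N.+2 | (i < k)%N) t k))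
        *: rho (omit i (fmap al y)) (rho (@snoc _ N.+1 x (y i)) v).

Definition eta_br_defect (s : 'I_N.+1 -> bool) (q : bool) x y v : V :=
  eta (br (snocA x y)) (alV v)
  - (rho (fmap al x) (eta y v)
     - (-1) ^+ (q * \sum_(k < N.+1) s k) *: eta (al y) (rho x v)).

Definition rho_mu_defect (s : 'I_N -> bool) (q r : bool) x y z v : V :=
  rho (@snoc _ N.+1 (fmap al x) (mu y z)) (alV v)
  - ((-1) ^+ (q * \sum_(k < N) s k) *: eta (al y) (rho (@snoc _ N.+1 x z) v)
     + (-1) ^+ (r * ((\sum_(k < N) s k) + q))
         *: eta (al z) (rho (@snoc _ N.+1 x y) v)).

Lemma base_al (M : nat) (w : {ffun 'I_M -> W}) : base (fmap Al w) = fmap al (base w).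
Proof. by apply/ffunP => i; rewrite !ffunE. Qed.

Lemma snd_sum (I : finType) (F : I -> W) : (\sum_i F i).2 = \sum_i (F i).2.
Proof. exact: (big_morph (@snd A V)). Qed.

Lemma snd_scale (c : K) (w : W) : (c *: w).2 = c *: w.2.
Proof. by []. Qed.

Lemma fst_scale (c : K) (w : W) : (c *: w).1 = c *: w.1.
Proof. by []. Qed.

Lemma fst_sum (I : finType) (F : I -> W) : (\sum_i F i).1 = \sum_i (F i).1.
Proof. exact: (big_morph (@fst A V)). Qed.

(** The coefficients are the signs that the left-hand side of the Hom-Jacobi
    identity gives to each slot; in the terms of the right-hand side, the sign of
    the slot differs from it exactly by the signs that occur in the axioms of a
    representation. *)
Lemma jacobi_defect s t (w : {ffun 'I_N.+1 -> W}) (z : {ffun 'I_N.+2 -> W}) :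
  homogs s w -> homogs t z ->
  (Br (snocV (fmap Al w) (Br z))).2
  - (\sum_(i < N.+2)
      (-1) ^+ ((\sum_(k < N.+1) s k) * (\sum_(k < N.+2 | (k < i)%N) t k))
        *: Br (upd (fmap Al z) i (Br (snocV w (z i))))).2 =
  \sum_(m < N.+1) ((-1) ^+ (s m * odd (\sum_(k < N.+2) t k)) * arg_sign s m)
     *: br_defect (fun j => s (lift m j)) t (omit m (base w)) (base z) (w m).2
  + \sum_(k < N.+2) slot_sign K t k
     *: comm_defect s (fun j => t (lift k j)) (base w) (omit k (base z)) (z k).2.
Proof.
move=> Hw Hz.
have AlH : forall p v, v \in homog W p -> Al v \in homog W p.
  by case: (sum_al_even Hal HalV).
have [_ BrH] := sum_br_even Hbr Hrho.
have HAlw : homogs s (fmap Al w) := homogs_fmap AlH Hw.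
have HAlz : homogs t (fmap Al z) := homogs_fmap AlH Hz.
have Hi i : Br (snocV w (z i)) \in homog W (odd (\sum_(k < N.+1) s k) (+) t i).
  have := BrH _ _ (homogs_snoc Hw (Hz i)).
  by rewrite sum_snoc oddD oddb.
rewrite (sum_br_snoc HAlw (BrH _ _ Hz)) base_al (sum_br_fst Hbr Hrho Hz).
rewrite (sum_br_snd Hbr Hrho Hz) snd_sum.
(* The right-hand side of the identity splits into three sums: the vector lies
   in x_m, in the y_k bracketed with x, or in another y_k. *)
transitivity (
    \sum_(m < N.+1)
      ((-1) ^+ (s m * odd (\sum_(k < N.+2) t k)) * arg_sign s m)
        *: rho (@snoc _ N.+1 (fmap al (omit m (base w))) (br (base z)))
             (alV (w m).2)
    + \sum_(k < N.+2) slot_sign K t k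
        *: rho (fmap al (base w)) (rho (omit k (base z)) (z k).2)
    - (\sum_(m < N.+1) \sum_(i < N.+2)
         ((-1) ^+ (s m * odd (\sum_(k < N.+2) t k)) * arg_sign s m)
           *: (((-1) ^+ (N.+2 - i.+1)
                * (-1) ^+ ((\sum_(k < N) s (lift m k))
                             * ((\sum_(k < N.+2) t k) + t i)
                           + t i * \sum_(k < N.+2 | (i < k)%N) t k))
              *: rho (omit i (fmap al (base z)))
                   (rho (@snoc _ N.+1 (omit m (base w)) (base z i)) (w m).2))
       + \sum_(k < N.+2) slot_sign K t k
           *: ((-1) ^+ ((\sum_(l < N.+1) s l) * (\sum_(l < N.+1) t (lift k l)))
              *: rho (fmap al (omit k (base z))) (rho (base w) (z k).2))
       + \sum_(k < N.+2) \sum_(i < N.+1) slot_sign K t k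
           *: ((-1) ^+ ((\sum_(l < N.+1) s l)
                        * (\sum_(l < N.+1 | (l < i)%N) t (lift k l)))
              *: rho (upd (fmap al (omit k (base z))) i
                        (br (snocA (base w) (omit k (base z) i))))
                   (alV (z k).2)))).
  congr (_ + _ - _).
  - by apply: eq_bigr => m _; rewrite fmap_omit ffunE.
  - by rewrite linear_sum; apply: eq_bigr => k _; rewrite linearZ.
  (* The term where y_i is bracketed with x and y_k is the vector. *)
  pose F (i k : 'I_N.+2) :=
    (-1) ^+ ((\sum_(l < N.+1) s l) * (\sum_(l < N.+2 | (l < i)%N) t l))
    *: (slot_sign K (upd (finfun t) i (odd (\sum_(l < N.+1) s l) (+) t i)) k
        *: rho (omit k (upd (fmap al (base z)) i (br (snocA (base w) (base z i)))))
             (alV (z k).2)).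
  have FE (k : 'I_N.+2) (i : 'I_N.+1) : F (lift k i) k = slot_sign K t k *: (
      (-1) ^+ ((\sum_(l < N.+1) s l) * (\sum_(l < N.+1 | (l < i)%N) t (lift k l)))
        *: rho (upd (fmap al (omit k (base z))) i
                  (br (snocA (base w) (omit k (base z) i)))) (alV (z k).2)).
    rewrite /F omit_upd_lift fmap_omit [omit k (base z) i]ffunE !scalerA.
    congr (_ *: _); rewrite /slot_sign upd_lift_at ffunE sum_lt_lift.
    do ?rewrite -exprD; rewrite -[LHS]signr_odd -[RHS]signr_odd.
    rewrite !(oddD, oddM) sum_gt_upd; congr (_ ^+ nat_of_bool _).
    by parity.
  under [X in _ + _ + X]eq_bigr do under eq_bigr do rewrite -FE.
  rewrite -exchange_lift exchange_big /= -!big_split /=.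
  apply: eq_bigr => i _.
  rewrite (sum_br_snd Hbr Hrho (homogs_upd i HAlz (Hi i))).
  rewrite [X in _ *: X = _](bigD1_ord i) // scalerDr scaler_sumr; congr (_ + _).
    rewrite upd_same fmap_upd base_al omit_upd (sum_br_snoc Hw (Hz i)).
    rewrite (linearD (rho _)) (linear_sum (rho _)) !scalerDr !scaler_sumr.
    congr (_ + _).
      apply: eq_bigr => m _; rewrite (linearZZ (rho _)) !scalerA [base z i]ffunE.
      congr (_ *: _).
      rewrite /arg_sign /slot_sign upd_same sum_gt_upd_same.
      rewrite snoc_lift !ffunE (sum_lift s m) (sum_split_at t i).
      by sign_eq.
    rewrite (fmap_omit al (base z) i) !scalerA; congr (_ *: _).
    rewrite /slot_sign upd_same sum_gt_upd_same sum_lift_split.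
    by sign_eq.
  apply: eq_bigr => k _.
  rewrite /F upd_lift fmap_upd base_al ffunE.
  by rewrite (sum_br_fst Hbr Hrho (homogs_snoc Hw (Hz i))) fmap_snoc [base z i]ffunE.
rewrite /br_defect /comm_defect.
under [X in _ = X + _]eq_bigr do rewrite scalerBr scaler_sumr.
under [X in _ = _ + X]eq_bigr do rewrite !scalerBr scaler_sumr.
rewrite !sumrB !opprD !addrA; congr (_ - _ - _).
by rewrite addrAC.
Qed.

Lemma sum_mu_snd p q (w z : W) : w \in homog W p -> z \in homog W q ->
  (Mu w z).2 = eta w.1 z.2 + (-1) ^+ (q * p) *: eta z.1 w.2.
Proof. by move=> Hw Hz; rewrite (sum_muE Hmu Heta Hw Hz). Qed.

Lemma sum_mu_fst p q (w z : W) : w \in homog W p -> z \in homog W q ->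
  (Mu w z).1 = mu w.1 z.1.
Proof. by move=> Hw Hz; rewrite (sum_muE Hmu Heta Hw Hz). Qed.

(** The vectors in place of y and z produce the same defect: commutativity of
    the product turns one case into the other. *)
Lemma leibniz_defect s q r (w : {ffun 'I_N.+1 -> W}) (y z : W) :
  homogs s w -> y \in homog W q -> z \in homog W r ->
  (Br (snocV (fmap Al w) (Mu y z))).2
  - ((-1) ^+ (q * \sum_(k < N.+1) s k) *: Mu (Al y) (Br (snocV w z))
     + Mu (Br (snocV w y)) (Al z)).2 =
  \sum_(m < N.+1) ((-1) ^+ (s m * (q (+) r)) * arg_sign s m)
     *: rho_mu_defect (fun j => s (lift m j)) q r (omit m (base w)) y.1 z.1 (w m).2
  - eta_br_defect s q (base w) y.1 z.2
  - (-1) ^+ (r * q) *: eta_br_defect s r (base w) z.1 y.2.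
Proof.
move=> Hw Hy Hz.
have [_ AlH] := sum_al_even Hal HalV.
have [_ BrH] := sum_br_even Hbr Hrho.
have [_ _ MuH] := sum_mu_even Hmu Heta.
have HAlw : homogs s (fmap Al w) := homogs_fmap AlH Hw.
have HB p (x : W) : x \in homog W p ->
    Br (snocV w x) \in homog W (odd (\sum_(k < N.+1) s k) (+) p).
  by move=> Hx; have := BrH _ _ (homogs_snoc Hw Hx); rewrite sum_snoc oddD oddb.
have B1 p (x : W) : x \in homog W p -> (Br (snocV w x)).1 = br (snocA (base w) x.1).
  by move=> Hx; rewrite (sum_br_fst Hbr Hrho (homogs_snoc Hw Hx)) fmap_snoc.
rewrite (sum_br_snoc HAlw (MuH _ _ _ _ Hy Hz)) (sum_mu_fst Hy Hz) (sum_mu_snd Hy Hz).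
rewrite [X in _ - X]/= (sum_mu_snd (AlH _ _ Hy) (HB _ _ Hz)).
rewrite (sum_mu_snd (HB _ _ Hy) (AlH _ _ Hz)) /= (B1 _ _ Hy) (B1 _ _ Hz).
rewrite (sum_br_snoc Hw Hy) (sum_br_snoc Hw Hz) base_al.
rewrite /eta_br_defect /rho_mu_defect.
under [X in _ = X - _ - _]eq_bigr do rewrite scalerBr scalerDr !scalerA.
rewrite sumrB big_split /= !(linearD (eta _)) (linearD (rho _)) !(linear_sum (eta _)).
rewrite (linearZZ (rho (fmap al (base w)))).
rewrite !scalerBr !scalerDr !scaler_sumr !scalerA.
have EY : \sum_(m < N.+1) (-1) ^+ (q * \sum_(k < N.+1) s k) *:
      eta (al y.1) (((-1) ^+ (s m * r) * arg_sign s m)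
        *: rho (@snoc _ N.+1 (omit m (base w)) z.1) (w m).2) =
    \sum_(m < N.+1)
      ((-1) ^+ (s m * (q (+) r)) * arg_sign s m *
       (-1) ^+ (q * \sum_(k < N) s (lift m k))) *:
      eta (al y.1) (rho (@snoc _ N.+1 (omit m (base w)) z.1) (w m).2).
  apply: eq_bigr => m _; rewrite (linearZZ (eta _)) scalerA; congr (_ *: _).
  by rewrite (sum_lift s m) /arg_sign /slot_sign snoc_lift ffunE; sign_eq.
have EZ : \sum_(m < N.+1) (-1) ^+ (r * (odd (\sum_(k < N.+1) s k) (+) q)) *:
      eta (al z.1) (((-1) ^+ (s m * q) * arg_sign s m)
        *: rho (@snoc _ N.+1 (omit m (base w)) y.1) (w m).2) =
    \sum_(m < N.+1)
      ((-1) ^+ (s m * (q (+) r)) * arg_sign s m *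
       (-1) ^+ (r * (\sum_(k < N) s (lift m k) + q))) *:
      eta (al z.1) (rho (@snoc _ N.+1 (omit m (base w)) y.1) (w m).2).
  apply: eq_bigr => m _; rewrite (linearZZ (eta _)) scalerA; congr (_ *: _).
  by rewrite (sum_lift s m) /arg_sign /slot_sign snoc_lift ffunE; sign_eq.
rewrite EY EZ.
have -> : (-1) ^+ (q * \sum_(k < N.+1) s k) *
    (-1) ^+ ((odd (\sum_(k < N.+1) s k) (+) r) * q) = (-1) ^+ (r * q) :> K.
  by sign_eq.
have -> : (-1) ^+ (r * (odd (\sum_(k < N.+1) s k) (+) q)) =
    (-1) ^+ (r * q) * (-1) ^+ (r * \sum_(k < N.+1) s k) :> K by sign_eq.
have -> : \sum_(m < N.+1) ((-1) ^+ (s m * (q (+) r)) * arg_sign s m) *: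
     rho (@snoc _ N.+1 (omit m (fmap al (base w))) (mu y.1 z.1)) (fmap Al w m).2 =
   \sum_(m < N.+1) ((-1) ^+ (s m * (q (+) r)) * arg_sign s m) *:
     rho (@snoc _ N.+1 (fmap al (omit m (base w))) (mu y.1 z.1)) (alV (w m).2).
  by apply: eq_bigr => m _; rewrite (fmap_omit al (base w) m) ffunE.
(* Pure reordering of the nine terms; the permutation is read off the two
   flattened sums. *)
by rewrite !(opprD, opprK) !addrA (ACl (1*4*8*7*2*5*6*3*9)).
Qed.

Let alVD : {morph alV : u v / u + v}.
Proof. exact: linear_funD (proj1 HalV). Qed.


Lemma br_defectD s t x y : {morph br_defect s t x y : u v / u + v}.
Proof.
move=> u v; rewrite /br_defect alVD linearD addrACA -opprD -big_split /=.
by congr (_ - _); apply: eq_bigr => i _; rewrite linearD linearD scalerDr.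
Qed.

Lemma comm_defectD s t x y : {morph comm_defect s t x y : u v / u + v}.
Proof.
move=> u v; rewrite /comm_defect alVD !(linearD (rho _)) scalerDr.
rewrite [RHS]addrACA -opprD -big_split /= [in RHS]addrACA -opprD.
by congr (_ - _); apply: eq_bigr => i _; rewrite linearD scalerDr.
Qed.

Lemma eta_br_defectD s q x y : {morph eta_br_defect s q x y : u v / u + v}.
Proof.
move=> u v; rewrite /eta_br_defect alVD !(linearD (rho _)) !(linearD (eta _)).
rewrite (linearD (rho _)) scalerDr.
by rewrite !(opprD, opprK) !addrA (ACl (1*3*5*2*4*6)).
Qed.

Lemma rho_mu_defectD s q r x y z : {morph rho_mu_defect s q r x y z : u v / u + v}.
Proof.
move=> u v; rewrite /rho_mu_defect alVD !(linearD (rho _)) !(linearD (eta _)).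
rewrite !scalerDr.
by rewrite !(opprD, opprK) !addrA (ACl (1*3*5*2*4*6)).
Qed.


Lemma morph0 (f : V -> V) : {morph f : u v / u + v} -> f 0 = 0.
Proof. by move=> fD; apply: (addrI (f 0)); rewrite -fD !addr0. Qed.

Lemma eq_comm_defect s t t' x y v :
  t =1 t' -> comm_defect s t x y v = comm_defect s t' x y v.
Proof.
move=> e; have E P : (\sum_(k < N.+1 | P k) t k = \sum_(k < N.+1 | P k) t' k)%N.
  by apply: eq_bigr => k _; rewrite e.
by rewrite /comm_defect E; congr (_ - _); apply: eq_bigr => i _; rewrite E.
Qed.

Lemma eq_br_defect s s' t x y v :
  s =1 s' -> br_defect s t x y v = br_defect s' t x y v.
Proof.
move=> e; have E : (\sum_(k < N) s k = \sum_(k < N) s' k)%N.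
  by apply: eq_bigr => k _; rewrite e.
by rewrite /br_defect E.
Qed.

Lemma eq_rho_mu_defect s s' q r x y z v :
  s =1 s' -> rho_mu_defect s q r x y z v = rho_mu_defect s' q r x y z v.
Proof.
move=> e; have E : (\sum_(k < N) s k = \sum_(k < N) s' k)%N.
  by apply: eq_bigr => k _; rewrite e.
by rewrite /rho_mu_defect E.
Qed.

Local Notation inA := (fun x : A => (x, 0) : W).
Local Notation inV := (fun v : V => (0, v) : W).

Lemma homog_inA p x : x \in homog A p -> inA x \in homog W p.
Proof. by move=> Hx; rewrite homog_dsum /= Hx homog0. Qed.

Lemma homog_inV p v : v \in homog V p -> inV v \in homog W p.
Proof. by move=> Hv; rewrite homog_dsum /= Hv homog0. Qed.

Lemma base_inA M (x : {ffun 'I_M -> A}) : base (fmap inA x) = x.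
Proof. by apply/ffunP => i; rewrite !ffunE. Qed.

Lemma slot_sign_eq0 (s : 'I_N.+2 -> bool) k (v : V) :
  slot_sign K s k *: v = 0 :> V -> v = 0.
Proof.
by rewrite /slot_sign -exprD => /signr_scaler_eq0.
Qed.

(** For the direct implication, y_n in V isolates the commutator formula, and
    x_(n-1) in V isolates the formula for rho(.., [y_1, .., y_n]). *)
Lemma sum_is_hom_lie : is_hom_lie br al ->
  is_hom_lie Br Al <-> is_hom_lie_rep br al rho alV.
Proof.
case=> _ _ skew_br jacobi; split=> [[_ _ _ Wjac] | [_ _ rep_comm rep_br]].
- have defect0 s t (w : {ffun 'I_N.+1 -> W}) (z : {ffun 'I_N.+2 -> W}) :
    homogs s w -> homogs t z ->
    \sum_(m < N.+1) ((-1) ^+ (s m * odd (\sum_(k < N.+2) t k)) * arg_sign s m)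
      *: br_defect (fun j => s (lift m j)) t (omit m (base w)) (base z) (w m).2
    + \sum_(k < N.+2) slot_sign K t k
      *: comm_defect s (fun j => t (lift k j)) (base w) (omit k (base z)) (z k).2
    = 0.
    by move=> Hw Hz; rewrite -jacobi_defect // (Wjac _ _ _ _ Hw Hz) subrr.
  split=> // [s t x y v Hx Hy | s t x y v Hx Hy];
    apply/eqP; rewrite -subr_eq0; apply/eqP.
    move: v; apply: (additive_homog_eq0 (comm_defectD s t x y)) => p v Hv.
    have := defect0 _ _ _ _ (homogs_base V Hx)
      (homogs_snoc (homogs_base V Hy) (homog_inV Hv)).
    rewrite big1 ?add0r => [|m _].
      rewrite (bigD1_ord ord_max) //= [X in _ + X]big1 ?addr0 => [|k _].
        rewrite slot_sign_max scale1r !snoc_max fmap_snoc !base_inA omit_max_snoc /=.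
        rewrite (@eq_comm_defect _ _ t); first by [].
        by move=> j; rewrite snoc_lift ffunE.
      by rewrite snoc_lift ffunE (morph0 (comm_defectD _ _ _ _)) scaler0.
    by rewrite ffunE (morph0 (br_defectD _ _ _ _)) scaler0.
  move: v; apply: (additive_homog_eq0 (br_defectD s t x y)) => p v Hv.
  have := defect0 _ _ _ _ (homogs_snoc (homogs_base V Hx) (homog_inV Hv))
    (homogs_base V Hy).
  rewrite [X in _ + X]big1 ?addr0 => [|k _].
    rewrite (bigD1_ord ord_max) //= [X in _ + X]big1 ?addr0 => [|m _].
      rewrite !snoc_max fmap_snoc !base_inA omit_max_snoc /=.
      rewrite -scalerA => E0; have {}E0 := signr_scaler_eq0 E0.
      move: (slot_sign_eq0 E0).
      rewrite (@eq_br_defect _ s); first by [].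
        by move=> j; rewrite snoc_lift ffunE.
    by rewrite !snoc_lift [fmap _ x m]ffunE (morph0 (br_defectD _ _ _ _)) scaler0.
  by rewrite ffunE (morph0 (comm_defectD _ _ _ _)) scaler0.
split; [exact: sum_al_even | exact: sum_br_even | exact: sum_br_skew |].
move=> s t w z Hw Hz; apply: injective_projections; last first.
  apply/eqP; rewrite -subr_eq0; apply/eqP; rewrite jacobi_defect //.
  rewrite [X in X + _]big1 ?add0r => [|m _]; first (apply: big1 => k _);
    rewrite [X in _ *: X](_ : _ = 0) ?scaler0 //;
    apply/eqP; rewrite subr_eq0; apply/eqP.
    by apply: rep_comm; [exact: homogs_fst | apply/homogs_omit/homogs_fst].
  by apply: rep_br; [apply/homogs_omit/homogs_fst | exact: homogs_fst].
have [_ AlH] := sum_al_even Hal HalV.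
have [_ BrH] := sum_br_even Hbr Hrho.
have HAlw : homogs s (fmap Al w) := homogs_fmap AlH Hw.
have HAlz : homogs t (fmap Al z) := homogs_fmap AlH Hz.
rewrite (sum_br_fst Hbr Hrho (homogs_snoc HAlw (BrH _ _ Hz))) fmap_snoc base_al.
rewrite (sum_br_fst Hbr Hrho Hz) (jacobi _ _ _ _ (homogs_fst Hw) (homogs_fst Hz)).
rewrite fst_sum; apply: eq_bigr => i _; rewrite fst_scale; congr (_ *: _).
have HB := homogs_snoc Hw (Hz i).
rewrite (sum_br_fst Hbr Hrho (homogs_upd i HAlz (BrH _ _ HB))) fmap_upd base_al.
by rewrite (sum_br_fst Hbr Hrho HB) fmap_snoc ffunE.
Qed.

(** Hom-associativity with the vector in the third place is the first axiom on
    eta, with the vector in the second place it is the other one; the first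
    place then gives nothing new. *)
Lemma sum_is_comm_hom_assoc : is_comm_hom_assoc mu al ->
  is_comm_hom_assoc Mu Al <-> is_hom_assoc_rep mu al eta alV.
Proof.
case=> _ _ assoc comm; have [_ AlH] := sum_al_even Hal HalV.
have [_ _ MuH] := sum_mu_even Hmu Heta.
have alV0 : alV 0 = 0 := morph0 alVD.
split=> [[_ _ Wassoc _] | [_ _ rep_mu rep_comm]].
- have assoc2 p q r (x y z : W) : x \in homog W p -> y \in homog W q ->
      z \in homog W r ->
      eta (mu x.1 y.1) (alV z.2) + (-1) ^+ (r * (p (+) q)) *:
        eta (al z.1) (eta x.1 y.2 + (-1) ^+ (q * p) *: eta y.1 x.2) =
      eta (al x.1) (eta y.1 z.2 + (-1) ^+ (r * q) *: eta z.1 y.2)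
      + (-1) ^+ ((q (+) r) * p) *: eta (mu y.1 z.1) (alV x.2).
    move=> Hx Hy Hz; have := congr1 snd (Wassoc _ _ _ _ _ _ Hx Hy Hz).
    rewrite (sum_mu_snd (MuH _ _ _ _ Hx Hy) (AlH _ _ Hz)).
    rewrite (sum_mu_snd (AlH _ _ Hx) (MuH _ _ _ _ Hy Hz)).
    by rewrite (sum_mu_fst Hx Hy) (sum_mu_fst Hy Hz) (sum_mu_snd Hx Hy) (sum_mu_snd Hy Hz).
  split=> // [p q x y v Hx Hy | p q x y v Hx Hy];
    apply/eqP; rewrite -subr_eq0; apply/eqP.
    move: v; apply: additive_homog_eq0 => [u v | r v Hv].
      by rewrite /= alVD !(linearD (eta _)) opprD addrACA.
    have := assoc2 _ _ _ _ _ _ (homog_inA Hx) (homog_inA Hy) (homog_inV Hv).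
    by rewrite /= alV0 !(linear0, scaler0, addr0) => ->; rewrite subrr.
  move: v; apply: additive_homog_eq0 => [u v | r v Hv].
    by rewrite /= !(linearD (eta _)) scalerDr opprD addrACA.
  have := assoc2 _ _ _ _ _ _ (homog_inA Hx) (homog_inV Hv) (homog_inA Hy).
  rewrite /= alV0 !(linear0, scaler0, addr0, add0r) (linearZZ (eta _)) => E.
  apply: (@signr_scaler_eq0 _ _ (q * r)); rewrite scalerBr -E scalerA.
  apply/eqP; rewrite subr_eq0; apply/eqP; congr (_ *: _); by sign_eq.
split; [exact: sum_al_even | exact: sum_mu_even | |].
  move=> p q r x y z Hx Hy Hz; apply: injective_projections.
    rewrite (sum_mu_fst (MuH _ _ _ _ Hx Hy) (AlH _ _ Hz)) (sum_mu_fst Hx Hy).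
    rewrite (sum_mu_fst (AlH _ _ Hx) (MuH _ _ _ _ Hy Hz)) (sum_mu_fst Hy Hz).
    by case/andP: Hx Hy Hz => Hx _ /andP[Hy _] /andP[Hz _]; apply: (assoc p q r).
  rewrite (sum_mu_snd (MuH _ _ _ _ Hx Hy) (AlH _ _ Hz)).
  rewrite (sum_mu_snd (AlH _ _ Hx) (MuH _ _ _ _ Hy Hz)).
  rewrite (sum_mu_fst Hx Hy) (sum_mu_fst Hy Hz) (sum_mu_snd Hx Hy) (sum_mu_snd Hy Hz).
  case/andP: Hx Hy Hz => Hx _ /andP[Hy _] /andP[Hz _] /=.
  rewrite (rep_mu _ _ _ _ _ Hx Hy) (rep_mu _ _ _ _ _ Hy Hz).
  rewrite !(linearD (eta _)) !(linearZZ (eta _)) (rep_comm _ _ _ _ _ Hz Hx).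
  rewrite (rep_comm _ _ _ _ _ Hz Hy) !scalerDr !scalerA addrA.
  by congr (_ + _ *: _ + _ *: _); sign_eq.
move=> p q x y Hx Hy; apply: injective_projections.
  rewrite fst_scale (sum_mu_fst Hx Hy) (sum_mu_fst Hy Hx).
  by case/andP: Hx Hy => Hx _ /andP[Hy _]; apply: comm.
rewrite snd_scale (sum_mu_snd Hx Hy) (sum_mu_snd Hy Hx) scalerDr scalerA addrC.
by rewrite -expr2 sqrr_sign scale1r mulnC.
Qed.

Lemma sum_leibniz :
  (forall (s : 'I_N.+1 -> bool) q r x y z,
    homogs s x -> y \in homog A q -> z \in homog A r ->
    br (snocA (fmap al x) (mu y z)) =
      (-1) ^+ (q * \sum_(k < N.+1) s k) *: mu (al y) (br (snocA x z))
      + mu (br (snocA x y)) (al z)) ->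
  (forall (s : 'I_N.+1 -> bool) q r (x : {ffun 'I_N.+1 -> W}) (y z : W),
    homogs s x -> y \in homog W q -> z \in homog W r ->
    Br (snocV (fmap Al x) (Mu y z)) =
      (-1) ^+ (q * \sum_(k < N.+1) s k) *: Mu (Al y) (Br (snocV x z))
      + Mu (Br (snocV x y)) (Al z)) <->
  (forall s q x y v, homogs s x -> y \in homog A q ->
    eta_br_defect s q x y v = 0) /\
  (forall s q r x y z v, homogs s x -> y \in homog A q -> z \in homog A r ->
    rho_mu_defect s q r x y z v = 0).
Proof.
move=> leib; split=> [Wleib | [rep_br rep_mu]].
  have defect0 s q r (w : {ffun 'I_N.+1 -> W}) (y z : W) :
    homogs s w -> y \in homog W q -> z \in homog W r ->
    \sum_(m < N.+1) ((-1) ^+ (s m * (q (+) r)) * arg_sign s m)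
     *: rho_mu_defect (fun j => s (lift m j)) q r (omit m (base w)) y.1 z.1 (w m).2
    - eta_br_defect s q (base w) y.1 z.2
    - (-1) ^+ (r * q) *: eta_br_defect s r (base w) z.1 y.2 = 0.
    by move=> Hw Hy Hz; rewrite -leibniz_defect // (Wleib _ _ _ _ _ _ Hw Hy Hz) subrr.
  split=> [s q x y v Hx Hy | s q r x y z v Hx Hy Hz].
    move: v; apply: (additive_homog_eq0 (eta_br_defectD s q x y)) => p v Hv.
    have := defect0 _ _ _ _ _ _ (homogs_base V Hx) (homog_inA Hy) (homog_inV Hv).
    rewrite base_inA [X in X - _ - _]big1 => [|m _].
      rewrite /= (morph0 (eta_br_defectD _ _ _ _)) scaler0 subr0 sub0r.
      by move/eqP; rewrite oppr_eq0 => /eqP.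
    by rewrite ffunE (morph0 (rho_mu_defectD _ _ _ _ _ _)) scaler0.
  move: v; apply: (additive_homog_eq0 (rho_mu_defectD s q r x y z)) => p v Hv.
  have := defect0 _ _ _ _ _ _ (homogs_snoc (homogs_base V Hx) (homog_inV Hv))
    (homog_inA Hy) (homog_inA Hz).
  rewrite /= !(morph0 (eta_br_defectD _ _ _ _)) scaler0 !subr0.
  rewrite (bigD1_ord ord_max) //= [X in _ + X]big1 ?addr0 => [|m _].
    rewrite !snoc_max fmap_snoc base_inA omit_max_snoc /=.
    rewrite -scalerA => E0; have {}E0 := signr_scaler_eq0 E0.
    move: (slot_sign_eq0 E0); rewrite (@eq_rho_mu_defect _ s) //.
    by move=> j; rewrite snoc_lift ffunE.
  by rewrite !snoc_lift [fmap _ x m]ffunE (morph0 (rho_mu_defectD _ _ _ _ _ _)) scaler0.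
move=> s q r w y z Hw Hy Hz; apply: injective_projections; last first.
  apply/eqP; rewrite -subr_eq0; apply/eqP; rewrite (leibniz_defect Hw Hy Hz).
  case/andP: Hy Hz => Hy _ /andP[Hz _].
  rewrite big1 => [|m _].
    by rewrite !rep_br ?scaler0 ?subr0 //; exact: homogs_fst.
  by rewrite rep_mu ?scaler0 //; exact: (homogs_omit m (homogs_fst Hw)).
have [_ AlH] := sum_al_even Hal HalV.
have [_ BrH] := sum_br_even Hbr Hrho.
have [_ _ MuH] := sum_mu_even Hmu Heta.
have HAlw : homogs s (fmap Al w) := homogs_fmap AlH Hw.
have HBy := homogs_snoc Hw Hy; have HBz := homogs_snoc Hw Hz.
rewrite (sum_br_fst Hbr Hrho (homogs_snoc HAlw (MuH _ _ _ _ Hy Hz))) fmap_snoc base_al.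
rewrite (sum_mu_fst Hy Hz) [RHS]/=.
rewrite (sum_mu_fst (AlH _ _ Hy) (BrH _ _ HBz)) (sum_mu_fst (BrH _ _ HBy) (AlH _ _ Hz)).
rewrite (sum_br_fst Hbr Hrho HBy) (sum_br_fst Hbr Hrho HBz) !fmap_snoc.
case/andP: Hy Hz => Hy _ /andP[Hz _].
by apply: leib Hy Hz; exact: homogs_fst.
Qed.

End Defects.

Theorem theorem3p1 (K : fieldType) (charK : [pchar K] =i pred0)
    (n : nat) (hn : (2 <= n)%N)
    (A : superspace K)
    (br : {ffun 'I_n -> A} -> A) (mu : A -> A -> A) (al : A -> A)
    (hA : is_hom_nambu_poisson br mu al)
    (V : superspace K)
    (rho : {ffun 'I_n.-1 -> A} -> {linear V -> V})
    (eta : A -> {linear V -> V}) (alV : V -> V)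
    (hrho : even_exterior_gl rho) (heta : even_linear_gl eta)
    (halV : even_linear alV) :
  is_hom_nambu_poisson (sum_br br rho) (sum_mu mu eta) (sum_al al alV) <->
  is_hom_nambu_poisson_rep br mu al rho eta alV.
Proof.
case: n hn br hA rho hrho => [|[|N]] // _ br [hassoc hlie hleib] rho hrho.
have [al_even mu_even _ _] := hassoc; have [_ br_even _ _] := hlie.
have Eassoc := sum_is_comm_hom_assoc al_even mu_even heta halV hassoc.
have Elie := sum_is_hom_lie al_even br_even hrho halV hlie.
have Eleib := sum_leibniz al_even mu_even br_even hrho heta halV hleib.
split=> [[/Eassoc rassoc /Elie rlie /Eleib[rbr rmu]]
       | [/Elie Wlie /Eassoc Wassoc rbr rmu]].
  split=> // [s q x y v Hx Hy | s q r x y z v Hx Hy Hz];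
    apply/eqP; rewrite -subr_eq0; apply/eqP.
    exact: rbr.
  exact: rmu.
split=> //; apply/Eleib; split=> [s q x y v Hx Hy | s q r x y z v Hx Hy Hz];
  apply/eqP; rewrite subr_eq0; apply/eqP.
  exact: rbr.
exact: rmu.
Qed.
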